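(* Let $m\ge2$ and $0\le l<m$ be integers, let $\Delta$ be the adjacency matrix of the Dynkin diagram $A_m$, and let $\alpha_1,\dots,\alpha_m$ be the coordinates of its Perron–Frobenius eigenvector. For a pair $(a,b)$ of edge labels $a,b\in\{1,\dots,m-1\}$ let $\varepsilon(a,b)\in\{1,-1\}$ be defined as follows: if $l$ is even, $\varepsilon(a,b)=-1$ exactly when $|a-b|\equiv2\pmod 4$; if $l$ is odd, $\varepsilon(a,b)=-1$ exactly when $b-a\equiv3\pmod4$. Define numbers $u(a,b)$, for all admissible pairs $(a,b)$ of edges, by the following two rules. 1. For $t\in\{0,1,\dots,l-1\}$ and $s\in\{0,1,\dots,m-l-1\}$: $$u(1+s+t,\;l-t+s)=\varepsilon(1+s+t,\,l-t+s)\sqrt{\frac{\alpha_{1+t}\,\alpha_{l-t}}{x_1x_2}},$$ where $x_1=\alpha_{2+s+t}$ if $s+t$ is even, $x_1=\alpha_{1+s+t}$ if $s+t$ is odd, $x_2=\alpha_{l-t+s+1}$ if $s-t$ is even, $x_2=\alpha_{l-t+s}$ if $s-t$ is odd. 2. For $t\in\{0,1,\dots,m-l-2\}$ and $s\in\{0,1,\dots,l\}$: $$u(1+s+t,\;l+t-s+1)=\varepsilon(1+s+t,\,l+t-s+1)\sqrt{\frac{\alpha_{1+t}\,\alpha_{l+2+t}}{y_1y_2}},$$ where $y_1=\alpha_{2+s+t}$ if $s+t$ is even, $y_1=\alpha_{1+s+t}$ if $s+t$ is odd, $y_2=\alpha_{l+t-s+1}$ if $s-t$ is even, $y_2=\alpha_{l+t-s+2}$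 if $s-t$ is odd. Then $u$ is a solution of the bi-unitary condition for the polynomial $R_l$ and the graph $A_m$, i.e. every block of $u$ and every block of the associated $v$ is a unitary matrix.
   Context: $A_m$ is the path with vertices $1,\dots,m$; the edge joining vertices $a$ and $a+1$ has label $a$ ($1\le a\le m-1$). For an edge $a$ let $\mathrm{ev}(a)$ be its even endpoint and $\mathrm{od}(a)$ its odd endpoint. Up to scaling $\alpha_j=\sin(jx)/\sin x$ with $x=\pi/(m+1)$. The polynomials $R_n$ are defined by $R_0(t)=1$, $R_1(t)=t$, $R_{n+1}(t)=tR_n(t)-R_{n-1}(t)$; the matrix $R_l(\Delta)$ has entries in $\{0,1\}$. Admissible pairs. If $l$ is even, an ordered pair of edges $(a,b)$ is admissible if $R_l(\Delta)_{\mathrm{od}(a),\mathrm{od}(b)}\ne0$ and $R_l(\Delta)_{\mathrm{ev}(a),\mathrm{ev}(b)}\neq0$. If $l$ is odd, $(a,b)$ is admissible if $R_l(\Delta)_{\mathrm{od}(a),\mathrm{ev}(b)}\ne0$ and $R_l(\Delta)_{\mathrm{ev}(a),\mathrm{od}(b)}\neq0$. The admissible pairs are exactly the pairs listed in rules 1 and 2. Blocks and transition from $u$ to $v$. For $l$ even: for an even vertex $p$ and an odd vertex $q$, the block of $u$ at $(p,q)$ is the matrix $(u(a,b))$ over all admissible $(a,b)$ with $\mathrm{ev}(a)=p$, $\mathrm{od}(b)=q$; put $v(a,b)=\sqrt{\frac{\alpha_{\mathrm{ev}(a)}\alpha_{\mathrm{od}(b)}}{\alpha_{\mathrm{od}(a)}\alpha_{\mathrm{ev}(b)}}}\,u(a,b)$,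 and for an odd vertex $q$ and an even vertex $p$ the block of $v$ at $(q,p)$ is the matrix $(v(a,b))$ over all admissible $(a,b)$ with $\mathrm{od}(a)=q$, $\mathrm{ev}(b)=p$. For $l$ odd: for even vertices $p,p'$ the block of $u$ at $(p,p')$ is the matrix $(u(a,b))$ over all admissible $(a,b)$ with $\mathrm{ev}(a)=p$, $\mathrm{ev}(b)=p'$; put $v(a,b)=\sqrt{\frac{\alpha_{\mathrm{ev}(a)}\alpha_{\mathrm{ev}(b)}}{\alpha_{\mathrm{od}(a)}\alpha_{\mathrm{od}(b)}}}\,u(a,b)$, and for odd vertices $q,q'$ the block of $v$ at $(q,q')$ is the matrix $(v(a,b))$ over all admissible $(a,b)$ with $\mathrm{od}(a)=q$, $\mathrm{od}(b)=q'$. In each block $a$ is the row index and $b$ the column index. *)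

(* Defs.v *)
From HB Require Import structures.
From mathcomp Require Import all_boot all_order all_algebra.
From mathcomp Require Import spectral reals complex zify.

Set Implicit Arguments.
Unset Strict Implicit.
Unset Printing Implicit Defensive.

Import Order.TTheory GRing.Theory Num.Theory.
Local Open Scope ring_scope.
Local Open Scope complex_scope.

(* Vertices of A_m are the naturals 1, ..., m and edges are their labels
   1, ..., m-1. Matrices indexed by the vertices are indexed by
   'I_m.-1.+1 (which is 'I_m for m > 0, written so that horner_mx applies),
   vertex j having index j - 1. *)

Definition vertex (m j : nat) : 'I_m.-1.+1 := inord j.-1.

Definition edge_labels (m : nat) : seq nat := iota 1 m.-1.

Definition ev (a : nat) : nat := if odd a then a.+1 else a.
Definition od (a : nat) : nat := if odd a then a else a.+1.

Section BiUnitary.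
Variable R : realType.
Implicit Types (m l p q a b s t : nat) (alpha : nat -> R).
Implicit Types (u f : nat -> nat -> R[i]).

Definition Delta m : 'M[R]_m.-1.+1 :=
  \matrix_(i, j) ((i.+1 == j :> nat) || (j.+1 == i :> nat))%:R.

Fixpoint Rpoly (n : nat) : {poly R} :=
  match n with
  | 0 => 1
  | n1.+1 => match n1 with
             | 0 => 'X
             | n2.+1 => 'X * Rpoly n1 - Rpoly n2
             end
  end.

Definition Rmx m l i j : R :=
  horner_mx (Delta m) (Rpoly l) (vertex m i) (vertex m j).

(* A positive eigenvector whose eigenvalue is the spectral radius. *)
Definition perron_frobenius n (A : 'M[R]_n) (v : 'cV[R]_n) : Prop :=
  exists lambda : R,
    [/\ A *m v = lambda *: v,
        forall i, 0 < v i 0 &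
        forall mu : R[i], eigenvalue (map_mx (fun x : R => x%:C) A) mu ->
          `|mu| <= lambda%:C].

Definition admissible m l a b : bool :=
  [&& a \in edge_labels m, b \in edge_labels m &
      if odd l
      then (Rmx m l (od a) (ev b) != 0) && (Rmx m l (ev a) (od b) != 0)
      else (Rmx m l (od a) (od b) != 0) && (Rmx m l (ev a) (ev b) != 0)].

(* The matrix of the values of f on the set of pairs P, whose rows and columns
   are the first and second components of the elements of P. The sets P used
   below are products: once the endpoint of a and the endpoint of b that label
   the block are fixed, admissibility is the conjunction of a condition on a
   and a condition on b. *)
Definition block_rows m (P : rel nat) : seq nat :=
  [seq a <- edge_labels m | has (fun b => P a b) (edge_labels m)].
Definition block_cols m (P : rel nat) : seq nat :=
  [seq b <- edge_labels m | has (fun a => P a b) (edge_labels m)].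
Definition block m (P : rel nat) f :
    'M[R[i]]_(size (block_rows m P), size (block_cols m P)) :=
  \matrix_(i, j) f (nth 0%N (block_rows m P) i) (nth 0%N (block_cols m P) j).

(* unitarymx alone only says M *m M^t* = 1. *)
Definition unitary_square r c (M : 'M[R[i]]_(r, c)) : Prop :=
  r = c /\ M \is unitarymx.

Definition v_of l alpha u a b : R[i] :=
  if odd l
  then (Num.sqrt (alpha (ev a) * alpha (ev b)
                  / (alpha (od a) * alpha (od b))))%:C * u a b
  else (Num.sqrt (alpha (ev a) * alpha (od b)
                  / (alpha (od a) * alpha (ev b))))%:C * u a b.

(* The pairs (a, b) in the block whose row edges have endpoint x via ea and
   whose column edges have endpoint y via eb. *)
Definition block_at m l (ea eb : nat -> nat) x y : rel nat :=
  fun a b => [&& admissible m l a b, ea a == x & eb b == y].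

Definition even_vertex m p : bool := (1 <= p <= m)%N && ~~ odd p.
Definition odd_vertex m q : bool := (1 <= q <= m)%N && odd q.

Definition biunitary m l alpha u : Prop :=
  let v := v_of l alpha u in
  if odd l then
    (forall p p', even_vertex m p -> even_vertex m p' ->
       unitary_square (block m (block_at m l ev ev p p') u)) /\
    (forall q q', odd_vertex m q -> odd_vertex m q' ->
       unitary_square (block m (block_at m l od od q q') v))
  else
    (forall p q, even_vertex m p -> odd_vertex m q ->
       unitary_square (block m (block_at m l ev od p q) u)) /\
    (forall q p, odd_vertex m q -> even_vertex m p ->
       unitary_square (block m (block_at m l od ev q p) v)).

Definition eps l a b : R :=
  if odd l
  then (if ((b%:Z - a%:Z)%R == 3 %[mod 4])%Z then -1 else 1)
  else (if (`|a - b| == 2 %[mod 4])%N then -1 else 1).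

(* In both rules `|s - t| is the distance, so that its parity is that of the
   integer s - t. *)
Definition rule1 m l alpha u : Prop :=
  forall t s, (t < l)%N -> (s < m - l)%N ->
    let a := (1 + s + t)%N in
    let b := (l - t + s)%N in
    let x1 := if ~~ odd (s + t) then alpha (2 + s + t)%N
              else alpha (1 + s + t)%N in
    let x2 := if ~~ odd `|s - t|%N then alpha (l - t + s + 1)%N
              else alpha (l - t + s)%N in
    u a b = (eps l a b
             * Num.sqrt (alpha (1 + t)%N * alpha (l - t)%N / (x1 * x2)))%:C.

Definition rule2 m l alpha u : Prop :=
  forall t s, (t < m - l - 1)%N -> (s <= l)%N ->
    let a := (1 + s + t)%N in
    let b := (l + t - s + 1)%N in
    let y1 := if ~~ odd (s + t) then alpha (2 + s + t)%N
              else alpha (1 + s + t)%N in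
    let y2 := if ~~ odd `|s - t|%N then alpha (l + t - s + 1)%N
              else alpha (l + t - s + 2)%N in
    u a b = (eps l a b
             * Num.sqrt (alpha (1 + t)%N * alpha (l + 2 + t)%N
                         / (y1 * y2)))%:C.

(* The two rules never prescribe conflicting values. *)
Lemma rules_consistent m l alpha :
  exists u, rule1 m l alpha u /\ rule2 m l alpha u.
Proof.
pose w1 s t : R[i] := (eps l (1 + s + t) (l - t + s) * Num.sqrt
  (alpha (1 + t)%N * alpha (l - t)%N /
   ((if ~~ odd (s + t) then alpha (2 + s + t)%N else alpha (1 + s + t)%N) *
    (if ~~ odd `|s - t|%N then alpha (l - t + s + 1)%N
     else alpha (l - t + s)%N))))%:C.
pose w2 s t : R[i] := (eps l (1 + s + t) (l + t - s + 1) * Num.sqrt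
  (alpha (1 + t)%N * alpha (l + 2 + t)%N /
   ((if ~~ odd (s + t) then alpha (2 + s + t)%N else alpha (1 + s + t)%N) *
    (if ~~ odd `|s - t|%N then alpha (l + t - s + 1)%N
     else alpha (l + t - s + 2)%N))))%:C.
exists (fun a b => if odd (a + b + l)
  then w1 (a + b - l - 1)./2 (a + l - b - 1)./2
  else w2 (a + l - b)./2 (a + b - l - 2)./2); split=> t s ht hs;
  cbv zeta.
- have -> : odd (1 + s + t + (l - t + s) + l) by lia.
  have -> : ((1 + s + t + (l - t + s) - l - 1)./2 = s)%N by lia.
  by have -> : ((1 + s + t + l - (l - t + s) - 1)./2 = t)%N by lia.
- have -> : odd (1 + s + t + (l + t - s + 1) + l) = false by lia.
  have -> : ((1 + s + t + l - (l + t - s + 1))./2 = s)%N by lia.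
  by have -> : ((1 + s + t + (l + t - s + 1) - l - 2)./2 = t)%N by lia.
Qed.

End BiUnitary.

(* Main.v *)
Require Import Defs.
From HB Require Import structures.
From mathcomp Require Import all_boot all_order all_algebra.
From mathcomp Require Import spectral reals complex.
From mathcomp Require Import zify ring.

(** The eigenvector is a sequence g satisfying g n.+2 = x * g n.+1 - g n with
    g 0 = g m.+1 = 0 (lemma perron_lucas), a multiple of j |-> sin (j pi/(m+1)),
    and every such sequence satisfies the product-to-sum identity
    g i * g j + g k * g (i + j + k) = g (i + k) * g (j + k)  (sine_product).

    The parity conventions in the two rules say that the denominators are the
    product of the coordinates at the two vertices labelling the block of u
    that contains (a, b); passing from u to v replaces them by the coordinates
    at the opposite endpoints, which label the block of v. So u and v are
    treated alike: on the block at (p, q),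
      f a b = eps a b * sqrt (weight a b / (g p * g q)),
    where weight a b depends only on a - b under rule 1 and only on a + b under
    rule 2 (rules_weight, v_weight).

    The edges at p are p - 1 and p, those at q are q - 1 and q, so a full block
    has squared moduli [[A, B], [B, A]] / (g p * g q). With p = i + k, q = j + k
    and l + 1 = i + j one finds A = g i * g j and B = g k * g (i + j + k), so
    the rows have norm 1 by the identity above, and they are orthogonal because
    the product of the four signs is -1 (eps_block). Near the border of the
    admissible region the block is a single entry; then the other summand
    vanishes because one of its factors is g 0 or g m.+1, and the entry has
    modulus 1 (block_unitary).

    Which pairs are admissible is read off the entries of R_l(Delta): by
    induction on l they are the 0/1 fusion coefficients of the truncated
    Clebsch-Gordan rule (Rmx_ord, admissibleE). *)

Set Implicit Arguments.
Unset Strict Implicit.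
Unset Printing Implicit Defensive.

Import Order.TTheory GRing.Theory Num.Theory.
Local Open Scope ring_scope.

(** * Admissible pairs and the entries of R_l(Delta) *)

Lemma sum_ord_eq (R : pzRingType) n c (F : nat -> R) :
  \sum_(k < n) (c == k :> nat)%:R * F k = if (c < n)%N then F c else 0.
Proof.
rewrite -(big_ord1_eq +%R F c n) [RHS]big_mkcond /=; apply: eq_bigr => k _.
by rewrite eq_sym; case: eqP; rewrite ?mul1r ?mul0r.
Qed.

(** Applying Delta to F adds the values at the two neighbours. *)
Lemma Delta_sum (R : realType) m (i : 'I_m.-1.+1) (F : nat -> R) :
  \sum_k Delta R m i k * F k =
    (if (i.+1 < m.-1.+1)%N then F i.+1 else 0)
    + (if (0 < i)%N then F i.-1 else 0).
Proof.
rewrite -sum_ord_eq.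
have -> : (if (0 < i)%N then F i.-1 else 0) =
          \sum_(k < m.-1.+1) (k.+1 == i :> nat)%:R * F k.
  case: i => -[|i] hi /=; first by rewrite big1 // => k _; rewrite mul0r.
  have := sum_ord_eq m.-1.+1 i F; rewrite (ltnW hi) => <-.
  by apply: eq_bigr => k _; rewrite eqSS eq_sym.
rewrite -big_split /=; apply: eq_bigr => k _.
rewrite mxE -mulrDl; congr (_ * _).
have [<-|_] := eqVneq i.+1 k; last by rewrite add0r.
by rewrite gtn_eqF ?addr0 // ltnS.
Qed.

(** The truncated Clebsch-Gordan condition, for i and j in 1, ..., m: the
    representations of dimensions i, j and l + 1 satisfy the fusion rule of
    SU(2) at level m - 1. *)
Definition fusion m l i j : bool :=
  [&& (i <= j + l)%N, (j <= i + l)%N, (l + 2 <= i + j)%N,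
      (i + j + l <= 2 * m)%N & ~~ odd (i + j + l)].

(** By R_(l+2) = Delta R_(l+1) - R_l, the induction step is the identity
    c_(l+1)(i+1, j) + c_(l+1)(i-1, j) = c_(l+2)(i, j) + c_l(i, j) between
    fusion coefficients. *)
Lemma Rmx_ord (R : realType) m l (i j : 'I_m.-1.+1) :
  (0 < m)%N -> (l < m)%N ->
  horner_mx (Delta R m) (Rpoly R l) i j = (fusion m l i.+1 j.+1)%:R.
Proof.
move=> m0.
suff H : (l < m)%N ->
   (forall i j, horner_mx (Delta R m) (Rpoly R l) i j
     = (fusion m l i.+1 j.+1)%:R) /\
   ((l.+1 < m)%N -> forall i j, horner_mx (Delta R m) (Rpoly R l.+1) i j
     = (fusion m l.+1 i.+1 j.+1)%:R).
  by move=> /H[].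
elim: l {i j} => [|l IHl] lm.
  split=> [i j|_ i j].
    rewrite rmorph1 mxE; congr (_%:R); congr nat_of_bool.
    by have := ltn_ord i; have := ltn_ord j; rewrite -val_eqE /fusion /=; lia.
  rewrite horner_mx_X mxE; congr (_%:R); congr nat_of_bool.
  by have := ltn_ord i; have := ltn_ord j; rewrite /fusion /=; lia.
have [IH0 IH1] := IHl (ltnW lm).
split=> [|lm2 i j]; first exact: IH1.
have -> : Rpoly R l.+2 = 'X * Rpoly R l.+1 - Rpoly R l by [].
rewrite rmorphB rmorphM /= horner_mx_X [LHS]mxE [X in _ + X]mxE IH0 mxE.
under eq_bigr => k _ do rewrite (IH1 lm).
rewrite (Delta_sum _ (fun k => (fusion m l.+1 k.+1 j.+1)%:R)).
case: i j => i hi [j hj] /=.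
apply/eqP; rewrite subr_eq; apply/eqP.
(* The fusion condition fails at the vertices 0 and m + 1, so the terms cut off
   at the ends of the path are zero anyway. *)
have -> : (if (i.+1 < m.-1.+1)%N then (fusion m l.+1 i.+2 j.+1)%:R else 0) =
          (fusion m l.+1 i.+2 j.+1)%:R :> R.
  case: ifP => // h; case: (boolP (fusion _ _ _ _)) => //.
  by rewrite /fusion; lia.
have -> : (if (0 < i)%N then (fusion m l.+1 i.-1.+1 j.+1)%:R else 0) =
          (fusion m l.+1 i j.+1)%:R :> R.
  case: i hi => //= hi; case: (boolP (fusion _ _ _ _)) => //.
  by rewrite /fusion; lia.
rewrite -!natrD; congr (_%:R).
case: (boolP (fusion m l.+1 i.+2 j.+1)); case: (boolP (fusion m l.+1 i j.+1));
  case: (boolP (fusion m l.+2 i.+1 j.+1)); case: (boolP (fusion m l i.+1 j.+1));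
  rewrite /fusion; lia.
Qed.

Lemma Rmx_neq0 (R : realType) m l i j :
  (l < m)%N -> (1 <= i <= m)%N -> (1 <= j <= m)%N ->
  (Rmx R m l i j != 0) = fusion m l i j.
Proof.
move=> lm hi hj; rewrite /Rmx Rmx_ord //; last by lia.
rewrite /vertex !inordK; try lia.
rewrite !prednK; try lia.
by case: fusion; rewrite ?oner_eq0 ?eqxx.
Qed.

(** Admissibility of a pair of edges as a list of inequalities, valid for both
    parities of l. *)
Definition adm m l a b : bool :=
  [&& (0 < a < m)%N, (0 < b < m)%N, (a <= b + l)%N, (b <= a + l)%N,
      (l < a + b)%N & (a + b + l < 2 * m)%N].

Lemma admissibleE (R : realType) m l a b :
  (l < m)%N -> admissible R m l a b = adm m l a b.
Proof.
move=> lm; rewrite /admissible /edge_labels !mem_iota.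
have [ha|ha] := boolP (0 < a < m)%N; last by rewrite /adm; lia.
have [hb|hb] := boolP (0 < b < m)%N; last by rewrite /adm; lia.
rewrite /od /ev /adm !(fun_if (Rmx R m l _)).
by case: (boolP (odd a)) => oa; case: (boolP (odd b)) => ob;
  case: (boolP (odd l)) => ol; rewrite !Rmx_neq0 // ?/fusion; lia.
Qed.

(** * The Perron-Frobenius eigenvector *)

Section Sine.
(* The model is g n = c sin (n y), with x = 2 cos y. *)
Variables (R : comPzRingType) (x : R) (g : nat -> R).
Hypotheses (g0 : g 0%N = 0) (gS : forall n, g n.+2 = x * g n.+1 - g n).

Lemma sine_add i j : g 1%N * g (i + j).+1 = g i.+1 * g j.+1 - g i * g j.
Proof.
suff: g 1%N * g (i + j).+1 = g i.+1 * g j.+1 - g i * g j /\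
      g 1%N * g (i + j).+2 = g i.+1 * g j.+2 - g i * g j.+1 by case.
elim: j => [|j [IH1 IH2]].
  by rewrite addn0 !gS g0; split; ring.
rewrite addnS; split=> //.
by rewrite !(gS (i + j).+1) (gS j.+1) mulrBr mulrCA IH2 IH1 !gS; ring.
Qed.

(** sin a sin b - sin (a - c) sin (b - c) = sin c sin (a + b - c), with a = i + k,
    b = j + k and c = k. Raising k by one increases both sides by the same
    amount g 1 * g (i + j + 2k + 1). *)
Lemma sine_product i j k :
  g i * g j + g k * g (i + j + k) = g (i + k) * g (j + k).
Proof.
elim: k => [|k IHk]; first by rewrite g0 !addn0; ring.
have e1 := sine_add k (i + j + k); have e2 := sine_add (i + k) (j + k).
rewrite (_ : (i + k + (j + k))%N = (k + (i + j + k))%N) in e2; last by lia.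
rewrite !addnS -[RHS](subrK (g (i + k) * g (j + k))) -e2 e1 -IHk; ring.
Qed.

End Sine.

(** The solution of g n.+2 = x * g n.+1 - g n with g 0 = 0 and g 1 = c. *)
Fixpoint lucas (R : pzRingType) (c x : R) n : R :=
  match n with
  | 0 => 0
  | n1.+1 => match n1 with
             | 0 => c
             | n2.+1 => x * lucas c x n1 - lucas c x n2
             end
  end.

(** The eigenvector equation at the vertices 1, ..., m - 1 makes alpha agree
    with the recurrent sequence, and at the vertex m it forces g m.+1 = 0. *)
Lemma perron_lucas (R : realType) m (alpha : nat -> R) : (0 < m)%N ->
  perron_frobenius (Delta R m) (\col_(i < m.-1.+1) alpha i.+1) ->
  exists x, let g := lucas (alpha 1%N) x in
  [/\ forall j, (0 < j <= m)%N -> g j = alpha j,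
      forall j, (0 < j <= m)%N -> 0 < g j & g m.+1 = 0].
Proof.
move=> m0 [x [eig pos _]]; exists x => g.
have gS j : g j.+2 = x * g j.+1 - g j by [].
have step j : (j < m)%N -> (if (j.+1 < m)%N then alpha j.+2 else 0) +
    (if (0 < j)%N then alpha j else 0) = x * alpha j.+1.
  move=> jm; have jm' : (j < m.-1.+1)%N by lia.
  have := congr1 (fun v : 'cV_m.-1.+1 => v (Ordinal jm') 0) eig.
  rewrite !mxE /=; under eq_bigr => k _ do rewrite mxE.
  rewrite (Delta_sum _ (fun k => alpha k.+1)) /= prednK // => <-.
  by congr (_ + _); case: j {jm jm'}.
have gE j : (j <= m)%N -> g j = if (0 < j)%N then alpha j else 0.
  suff H : (j <= m)%N -> (g j = if (0 < j)%N then alpha j else 0) /\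
           ((j < m)%N -> g j.+1 = alpha j.+1) by case/H.
  elim: j => [|j IHj] jm; first by split.
  have [IH1 IH2] := IHj (ltnW jm); split=> [|jm2]; first exact: IH2.
  by rewrite gS IH2 // IH1 -(step _ jm) jm2 addrK.
split=> [j /andP[j0 jm]|j /andP[j0 jm]|]; first by rewrite gE // j0.
- have jm' : (j.-1 < m.-1.+1)%N by lia.
  by rewrite gE // j0; have := pos (Ordinal jm'); rewrite mxE /= prednK.
case: m {eig pos} m0 gE step => // n _ gE step.
have /= := step n (ltnSn n); rewrite ltnn add0r => e.
by rewrite gS !gE //= -e subrr.
Qed.

(** * Unitary blocks *)

Section Blocks.
Variable R : realType.
Implicit Types (f : nat -> nat -> R[i]) (w : nat -> nat -> R).

(** The matrix of the values of f on rs x cs, for lists of labels rs and cs. *)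
Definition list_mx rs cs f : 'M[R[i]]_(size rs, size cs) :=
  \matrix_(i, j) f (nth 0%N rs i) (nth 0%N cs j).

(** If P is the product rs x cs, its block is list_mx rs cs f; rs and cs must be
    empty together, because an empty product has neither rows nor columns. *)
Lemma block_rect m (P : rel nat) f rs cs :
    sorted ltn rs -> sorted ltn cs -> (rs == [::]) = (cs == [::]) ->
    {subset rs <= edge_labels m} -> {subset cs <= edge_labels m} ->
    (forall a b, P a b = (a \in rs) && (b \in cs)) ->
  unitary_square (list_mx rs cs f) -> unitary_square (block m P f).
Proof.
move=> srs scs nilE rs_m cs_m PE.
have sorted_edge p : sorted ltn [seq a <- edge_labels m | p a].
  by rewrite (sorted_filter ltn_trans) // iota_ltn_sorted.
rewrite -[block m P f]/(list_mx (block_rows m P) (block_cols m P) f).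
suff [-> ->] : block_rows m P = rs /\ block_cols m P = cs by [].
split; apply: (irr_sorted_eq ltn_trans ltnn (sorted_edge _)) => // e;
  rewrite mem_filter.
- apply/andP/idP => [[/hasP[b _]]|ers]; first by rewrite PE => /andP[].
  split; last exact: rs_m.
  case: cs cs_m {scs} PE nilE => [|b cs] cs_m PE nilE; last first.
    by apply/hasP; exists b; rewrite ?PE ?ers ?cs_m ?mem_head.
  by case: (rs) nilE ers.
- apply/andP/idP => [[/hasP[a _]]|ecs]; first by rewrite PE => /andP[].
  split; last exact: cs_m.
  case: rs rs_m {srs} PE nilE => [|a rs] rs_m PE nilE; last first.
    by apply/hasP; exists a; rewrite ?PE ?ecs ?rs_m ?mem_head.
  by case: (cs) nilE ecs.
Qed.

Lemma unitary_nil f : unitary_square (list_mx [::] [::] f).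
Proof. by split=> //; apply/unitarymxP/matrixP => -[]. Qed.

Lemma conj_real (x : R) : (x%:C%C : R[i])^* = x%:C%C.
Proof. exact: conjc_real. Qed.

Lemma unitary_1 a b f w : f a b = (w a b)%:C%C -> w a b ^+ 2 = 1 ->
  unitary_square (list_mx [:: a] [:: b] f).
Proof.
move=> fE w1; split=> //; apply/unitarymxP/matrixP => i j.
rewrite !ord1 !mxE big_ord_recl big_ord0 addr0 !mxE /= fE conj_real.
by rewrite -rmorphM /= -expr2 w1.
Qed.

Lemma unitary_2 a a' b b' f w :
    (forall c d, c \in [:: a; a'] -> d \in [:: b; b'] ->
       f c d = (w c d)%:C%C) ->
    w a b ^+ 2 + w a b' ^+ 2 = 1 -> w a' b ^+ 2 + w a' b' ^+ 2 = 1 ->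
    w a b * w a' b + w a b' * w a' b' = 0 ->
  unitary_square (list_mx [:: a; a'] [:: b; b'] f).
Proof.
move=> fE w1 w2 w0; split=> //; apply/unitarymxP/matrixP => i j.
rewrite !mxE !big_ord_recl big_ord0 addr0 !mxE /=.
have {}fE : [/\ f a b = (w a b)%:C, f a b' = (w a b')%:C,
    f a' b = (w a' b)%:C & f a' b' = (w a' b')%:C]%C.
  by split; apply: fE; rewrite !inE eqxx ?orbT.
case: fE => e1 e2 e3 e4.
by case: i j => -[|[|//]] ? [[|[|//]] ?];
  rewrite /= ?e1 ?e2 ?e3 ?e4 !conj_real -!rmorphM -rmorphD /= -?expr2
     ?w1 ?w2 // 1?[w a' b * _]mulrC 1?[w a' b' * _]mulrC w0.
Qed.

(** The numerators under the square roots of rule 1 (a + b + l odd) and rule 2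
    (a + b + l even), written in terms of a and b. *)
Definition weight (g : nat -> R) l a b : R :=
  if odd (a + b + l)
  then g (a + l.+1 - b)./2 * g (b + l.+1 - a)./2
  else g (a + b - l)./2 * g (a + b + l).+2./2.

Lemma eps_sqr l a b : eps R l a b ^+ 2 = 1.
Proof. by rewrite /eps; do 2![case: ifP => _]; rewrite ?sqrrN expr1n. Qed.

(** The diagonal entries of a 2 x 2 block have sign 1, the other two have
    opposite signs. *)
Lemma eps_block l p q : (0 < p)%N -> (0 < q)%N -> odd (p + q + l) ->
  eps R l p.-1 q.-1 * eps R l p q.-1 + eps R l p.-1 q * eps R l p q = 0.
Proof.
move=> p0 q0 o; have diag a b : odd (a + b + l) -> eps R l a b = 1.
  by move=> ab; rewrite /eps; do 2![case: ifP => ?] => //; lia.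
rewrite (diag p.-1 q.-1); last by lia.
rewrite (diag p q); last by lia.
rewrite mul1r mulr1 /eps.
by case: ifP => ol; do 2![case: ifP => ?]; rewrite ?addNr ?addrN //; lia.
Qed.

(** The edge a is incident to the vertex p; at the ends of the path one of the
    two values allowed for a, namely 0 or m, is not an edge label. *)
Definition incident p a : bool := (a == p) || (a == p.-1).

(** The common statement for u and v: p and q stand for the vertices labelling
    the block, whichever their parities. *)
Lemma block_unitary m l (g : nat -> R) f p q (P : rel nat) (x : R) :
    g 0%N = 0 -> (forall n, g n.+2 = x * g n.+1 - g n) -> g m.+1 = 0 ->
    (forall n, (0 < n <= m)%N -> 0 < g n) ->
    (l < m)%N -> (0 < p <= m)%N -> (0 < q <= m)%N -> odd (p + q + l) ->
    (forall a b, P a b = [&& adm m l a b, incident p a & incident q b]) ->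
    (forall a b, P a b ->
       f a b = (eps R l a b * Num.sqrt (weight g l a b / (g p * g q)))%:C%C) ->
  unitary_square (block m P f).
Proof.
move=> g0 gS gm gpos lm pm qm o PE fE.
pose w a b := eps R l a b * Num.sqrt (weight g l a b / (g p * g q)).
have gge0 n : (n <= m.+1)%N -> 0 <= g n.
  case: n => [|n] nm; first by rewrite g0.
  have [->|nm'] := eqVneq n m; first by rewrite gm.
  by apply/ltW/gpos; lia.
have c0 : 0 < g p * g q by rewrite mulr_gt0 ?gpos.
have w2 a b : 0 <= weight g l a b -> w a b ^+ 2 = weight g l a b / (g p * g q).
  move=> h; rewrite exprMn eps_sqr mul1r sqr_sqrtr //.
  by rewrite divr_ge0 // ltW.
have empty : (forall a b, P a b = false) -> unitary_square (block m P f).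
  by move=> P0; apply: block_rect (unitary_nil f).
have single a b : P a b -> (forall c d, P c d -> (c = a) /\ (d = b)) ->
    weight g l a b = g p * g q -> unitary_square (block m P f).
  move=> Pab Pu wE.
  have := Pab; rewrite PE => /andP[/and3P[am bm _] _].
  apply: (@block_rect _ _ _ [:: a] [:: b]) => //.
  - by move=> c; rewrite inE => /eqP ->; rewrite mem_iota; lia.
  - by move=> c; rewrite inE => /eqP ->; rewrite mem_iota; lia.
  - move=> c d; rewrite !inE; apply/idP/andP => [/Pu[-> ->]|] //.
    by case=> /eqP-> /eqP->.
  - apply: (@unitary_1 _ _ _ w); first exact: fE.
    by rewrite w2 wE ?ltW // divff // gt_eqF.
have none : ~~ ((p <= q + l.+1) && (q <= p + l.+1) && (l < p + q))%N ->
    unitary_square (block m P f).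
  move=> h; apply: empty => a b; rewrite PE; apply/negP.
  by rewrite /adm /incident; lia.
(* Outside these inequalities the block is empty; inside, they are what makes
   i, j and k below natural numbers. *)
have [h|/none //] :=
  boolP ((p <= q + l.+1) && (q <= p + l.+1) && (l < p + q))%N.
have [i [j [k [pE qE lE]]]] : exists i j k,
    [/\ p = i + k, q = j + k & l.+1 = i + j]%N.
  exists ((p + l.+1 - q)./2), ((q + l.+1 - p)./2), ((p + q - l.+1)./2).
  by split; lia.
have prod := sine_product g0 gS i j k; rewrite -pE -qE in prod.
have wD a b : (a + q = b + p)%N -> weight g l a b = g i * g j.
  move=> ab; rewrite /weight ifT; last by lia.
  by congr (g _ * g _); lia.
have wS a b : (a + b).+1 = (p + q)%N -> weight g l a b = g k * g (i + j + k)%N.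
  move=> ab; rewrite /weight ifF; last by lia.
  by congr (g _ * g _); lia.
(* One entry is left when i, j or k is 0, or when i + j + k = m + 1; the block
   is empty when i + j + k > m + 1. *)
have [i0|i0] := posnP i.
  apply: (single p q.-1).
  - by rewrite PE /adm /incident; lia.
  - by move=> c d; rewrite PE /adm /incident; lia.
  - by rewrite wS ?prednK -?prod ?i0 ?g0 ?mul0r ?add0r //; lia.
have [j0|j0] := posnP j.
  apply: (single p.-1 q).
  - by rewrite PE /adm /incident; lia.
  - by move=> c d; rewrite PE /adm /incident; lia.
  - by rewrite wS ?prednK -?prod ?j0 ?g0 ?mulr0 ?add0r //; lia.
have [k0|k0] := posnP k.
  apply: (single p q).
  - by rewrite PE /adm /incident; lia.
  - by move=> c d; rewrite PE /adm /incident; lia.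
  - by rewrite wD -?prod ?k0 ?g0 ?mul0r ?addr0 //; lia.
have [big|small] := ltnP m (i + j + k).
  have [top|ntop] := eqVneq (i + j + k)%N m.+1; last first.
    by apply: empty => a b; rewrite PE; apply/negP; rewrite /adm /incident; lia.
  apply: (single p.-1 q.-1).
  - by rewrite PE /adm /incident; lia.
  - by move=> c d; rewrite PE /adm /incident; lia.
  - by rewrite wD -?prod ?top ?gm ?mulr0 ?addr0 //; lia.
have PE' a b : P a b = (a \in [:: p.-1; p]) && (b \in [:: q.-1; q]).
  by rewrite PE !inE /adm /incident; lia.
have A0 : 0 <= g i * g j by rewrite mulr_ge0 ?gge0 //; lia.
have B0 : 0 <= g k * g (i + j + k)%N by rewrite mulr_ge0 ?gge0 //; lia.
have w11 : weight g l p.-1 q.-1 = g i * g j by apply: wD; lia.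
have w22 : weight g l p q = g i * g j by apply: wD; lia.
have w12 : weight g l p.-1 q = g k * g (i + j + k)%N by apply: wS; lia.
have w21 : weight g l p q.-1 = g k * g (i + j + k)%N by apply: wS; lia.
apply: (@block_rect _ _ _ [:: p.-1; p] [:: q.-1; q]) => //.
- by rewrite /= andbT; lia.
- by rewrite /= andbT; lia.
- by move=> c; rewrite !inE mem_iota; lia.
- by move=> c; rewrite !inE mem_iota; lia.
apply: (@unitary_2 _ _ _ _ _ w).
- by move=> c d hc hd; apply: fE; rewrite PE' hc hd.
- by rewrite !w2 ?w11 ?w12 // -mulrDl prod divff // gt_eqF.
- by rewrite !w2 ?w21 ?w22 // -mulrDl addrC prod divff // gt_eqF.
rewrite /w w11 w12 w21 w22; set sA := Num.sqrt _; set sB := Num.sqrt _.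
transitivity ((eps R l p.-1 q.-1 * eps R l p q.-1
               + eps R l p.-1 q * eps R l p q) * (sA * sB)); first by ring.
by rewrite eps_block ?mul0r //; lia.
Qed.
End Blocks.

(** * The values given by the two rules *)

Ltac if_lia := repeat case: ifPn => ?; lia.

(** The parities select in both rules the coordinates of the eigenvector at
    ev a and at the endpoint of b that labels the block of u. *)
Lemma rules_weight (R : realType) m l (alpha g : nat -> R) u a b :
    (l < m)%N -> (forall j, (0 < j <= m)%N -> g j = alpha j) ->
    rule1 m l alpha u -> rule2 m l alpha u -> adm m l a b ->
  u a b = (eps R l a b * Num.sqrt (weight g l a b
     / (g (ev a) * g (if odd l then ev b else od b))))%:C%C.
Proof.
move=> lm gE r1 r2 ab; rewrite /adm in ab.
rewrite /weight; case: ifPn => o.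
- have [t [s [aE bE tl sm]]] : exists t s,
      [/\ a = 1 + s + t, b = l - t + s, t < l & s < m - l]%N.
    by exists ((a + l - b.+1)./2), ((a + b - l.+1)./2); split; lia.
  have := r1 t s tl sm; cbv zeta; rewrite -aE -bE -!(fun_if alpha) => ->.
  rewrite -!gE; try if_lia.
  by congr (_ * _)%:C%C; congr (Num.sqrt (g _ * g _ / (g _ * g _)));
    rewrite /ev /od; if_lia.
- have [t [s [aE bE tm sl]]] : exists t s,
      [/\ a = 1 + s + t, b = l + t - s + 1, t < m - l - 1 & s <= l]%N.
    by exists ((a + b - l.+2)./2), ((a + l - b)./2); split; lia.
  have := r2 t s tm sl; cbv zeta; rewrite -aE -bE -!(fun_if alpha) => ->.
  rewrite -!gE; try if_lia.
  by congr (_ * _)%:C%C; congr (Num.sqrt (g _ * g _ / (g _ * g _)));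
    rewrite /ev /od; if_lia.
Qed.

Lemma v_weight (R : realType) m l (alpha g : nat -> R) u a b :
    (l < m)%N -> (forall j, (0 < j <= m)%N -> g j = alpha j) ->
    (forall j, (0 < j <= m)%N -> 0 < g j) ->
    rule1 m l alpha u -> rule2 m l alpha u -> adm m l a b ->
  v_of l alpha u a b = (eps R l a b * Num.sqrt (weight g l a b
     / (g (od a) * g (if odd l then od b else ev b))))%:C%C.
Proof.
move=> lm gE gpos r1 r2 ab; rewrite /v_of !(rules_weight lm gE r1 r2 ab).
have [a0 b0] : (0 < a < m)%N /\ (0 < b < m)%N by move: ab; rewrite /adm; lia.
have ev_m c : (0 < c < m)%N -> (0 < ev c <= m)%N by rewrite /ev; if_lia.
have od_m c : (0 < c < m)%N -> (0 < od c <= m)%N by rewrite /od; if_lia.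
have key x y z w : (0 < x <= m)%N -> (0 < y <= m)%N -> (0 < z <= m)%N ->
    (0 < w <= m)%N ->
    (Num.sqrt (alpha x * alpha y / (alpha z * alpha w)))%:C%C *
      (eps R l a b * Num.sqrt (weight g l a b / (g x * g y)))%:C%C =
    (eps R l a b * Num.sqrt (weight g l a b / (g z * g w)))%:C%C :> R[i].
  move=> hx hy hz hw; rewrite -rmorphM /= -!gE //.
  have [px py pz pw] : [/\ 0 < g x, 0 < g y, 0 < g z & 0 < g w].
    by split; apply: gpos.
  rewrite mulrCA -sqrtrM; last by rewrite divr_ge0 // mulr_ge0 ?ltW.
  congr (_ * Num.sqrt _)%:C%C; field.
  by rewrite !gt_eqF.
by case: ifP => ol; rewrite ?ol; apply: key; auto.
Qed.

Theorem theorem12p1 (R : realType) (m l : nat) (alpha : nat -> R)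
    (u : nat -> nat -> R[i]) :
  (2 <= m)%N -> (l < m)%N ->
  perron_frobenius (Delta R m) (\col_(i < m.-1.+1) alpha i.+1) ->
  rule1 m l alpha u -> rule2 m l alpha u ->
  biunitary m l alpha u.
Proof.
move=> m2 lm pf r1 r2; have m0 : (0 < m)%N by lia.
have [x [gE gpos gm]] := perron_lucas m0 pf; set g := lucas _ _ in gE gpos gm.
have uE a b := @rules_weight R m l alpha g u a b lm gE r1 r2.
have vE a b := @v_weight R m l alpha g u a b lm gE gpos r1 r2.
have main := @block_unitary R m l g _ _ _ _ x erefl (fun=> erefl) gm gpos lm.
have ev_incident p a : even_vertex m p -> (ev a == p) = incident p a.
  by rewrite /even_vertex /ev /incident; if_lia.
have od_incident q a : odd_vertex m q -> (od a == q) = incident q a.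
  by rewrite /odd_vertex /od /incident; if_lia.
rewrite /biunitary; case: ifP => ol; rewrite ?ol in uE vE; split=> y z hy hz;
  (apply: (main _ y z);
   [by move: hy; rewrite /even_vertex /odd_vertex; lia
   |by move: hz; rewrite /even_vertex /odd_vertex; lia
   |by move: hy hz; rewrite /even_vertex /odd_vertex; lia
   |by move=> a b; rewrite /block_at admissibleE //
         ?(ev_incident _ _ hy) ?(ev_incident _ _ hz)
         ?(od_incident _ _ hy) ?(od_incident _ _ hz)
   |move=> a b /and3P[]; rewrite admissibleE // => ab /eqP <- /eqP <-]);
  by [exact: uE|exact: vE].
Qed.
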